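(* Let $\mathbb{X}=\{a,b,c\}$ (three distinct states), with $\mathbb{P}_a(X_1=c)=0$ and $\mathbb{P}_x(X_1=y)>0$ for all $(x,y)\in\mathbb{X}\times\mathbb{X}$ with $(x,y)\ne(a,c)$. Given $M>0$, define the payoff functions by $$\begin{aligned} f_1(a)&=1,& g_1(a)&=M^2,& f_2(a)&=M,& g_2(a)&=M+1,\\ f_1(b)&=M,& g_1(b)&=M+1,& f_2(b)&=1,& g_2(b)&=2,\\ f_1(c)&=1,& g_1(c)&=2,& f_2(c)&=M^2,& g_2(c)&=M^2+1, \end{aligned}$$ and $h_i(x)=\tfrac12(f_i(x)+g_i(x))$ for all $x\in\mathbb{X}$ and $i\in\{1,2\}$. Then, for all $M>0$ large enough (with the transition probabilities and the discount functions $\delta_1,\delta_2$ fixed), the condition ''for each $i\in\{1,2\}$, $(\delta_i(t)g_i(X_t^x))_{t\ge0}$ is a supermartingale for all $x\in\mathbb{X}$'' is violated, and there exists no soft inter-personal equilibrium.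
   Context: Setting (nonzero-sum Dynkin game). $\mathbb{Z}_+=\{0,1,2,\dots\}$. $X=(X_t)_{t\in\mathbb{Z}_+}$ is a time-homogeneous Markov chain with values in $\mathbb{X}$ (here finite, with $\mathcal{B}=2^{\mathbb{X}}$), on the path space of functions $\mathbb{Z}_+\to\mathbb{X}$; $(\mathcal{F}_t)$ is the filtration generated by $X$, $\mathcal{T}$ is the set of $(\mathcal{F}_t)$-stopping times (allowed to take the value $+\infty$), $X^x$ is the process $X$ with $X_0=x$, $\mathbb{P}_x$ is its law, and $\mathbb{E}_x$ the corresponding expectation. For $i\in\{1,2\}$, the discount function $\delta_i:\mathbb{Z}_+\to[0,1]$ is strictly decreasing with $\delta_i(0)=1$ and $\delta_i(s)\delta_i(t)\le\delta_i(s+t)$ for all $s,t\in\mathbb{Z}_+$. For payoff functions $f_i,g_i,h_i:\mathbb{X}\to[0,\infty)$ and $\tau,\sigma\in\mathcal{T}$, $$F_i(\tau,\sigma):=\delta_i(\tau)f_i(X_\tau)1_{\{\tau<\sigma\}}+\delta_i(\sigma)g_i(X_\sigma)1_{\{\tau>\sigma\}}+\delta_i(\tau)h_i(X_\tau)1_{\{\tau=\sigma\}},$$ with $F_i(\tau,\sigma):=\limsup_{t\to\infty}\delta_i(t)h_i(X_t)$ on $\{\tau=\sigma=+\infty\}$, and $J_i(x,\tau,\sigma):=\mathbb{E}_x[F_i(\tau,\sigma)]$. Here $\tau$ is Player $i$'s stopping time and $\sigma$ the other player's. Stopping policies are sets $S\in\mathcal{B}$. Put $\rho_S:=\inf\{t\ge0:X_t\in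 S\}$ and $\rho_S^+:=\inf\{t>0:X_t\in S\}$ ($\inf\emptyset=\infty$). Equilibria. For $S,T\in\mathcal{B}$ let $$\Theta_i^T(S):=\{x\in S: J_i(x,0,\rho_T)\ge J_i(x,\rho_S^+,\rho_T)\}\cup\{x\notin S: J_i(x,0,\rho_T)>J_i(x,\rho_S^+,\rho_T)\}.$$ $S$ is an intra-personal equilibrium of Player $i$ with respect to $T$ if $\Theta_i^T(S)=S$; $\mathcal{E}_i^T$ is the set of these. $(S,T)\in\mathcal{B}\times\mathcal{B}$ is a soft inter-personal equilibrium if $S\in\mathcal{E}_1^T$ and $T\in\mathcal{E}_2^S$. *)

(* Defs.v *)
From HB Require Import structures.
From mathcomp Require Import all_boot all_order all_algebra.
From mathcomp Require Import all_classical all_reals all_analysis.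
Import Order.TTheory GRing.Theory Num.Theory.
Import numFieldNormedType.Exports.

Set Implicit Arguments.
Unset Strict Implicit.
Unset Printing Implicit Defensive.

Local Open Scope classical_set_scope.
Local Open Scope ring_scope.

(* Measurable types are pointed, so the state space must be; the distinguished
   point plays no other role. *)
#[short(type="pointedFinType")]
HB.structure Definition PointedFinite := {X of Pointed X & Finite X}.

Definition coordinate_events (X : Type) (I : set nat) : set (set (nat -> X)) :=
  [set A | exists2 t, I t & exists x, A = [set w | w t = x]].

Definition trajectory (X : pointedFinType) :=
  g_sigma_algebraType (@coordinate_events X [set: nat]).

Definition natural_filtration (X : Type) (t : nat) : set (set (nat -> X)) :=
  <<s coordinate_events [set s | (s <= t)%N] >>.

(* P x is the law of the chain started at x.  The second clause is the
   time-homogeneous Markov property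
     P_x(X_(n+1) = y | X_0 = w_0, ..., X_n = w_n) = P_(w_n)(X_1 = y),
   multiplied out so that null histories need no special treatment. *)
Definition markov_chain (R : realType) (X : pointedFinType)
    (P : X -> probability (trajectory X) R) : Prop :=
  (forall x, P x [set w | w 0%N = x] = 1%E) /\
  (forall (x : X) (n : nat) (w : nat -> X) (y : X),
     let history := [set v : nat -> X | forall k, (k <= n)%N -> v k = w k] in
     P x (history `&` [set v | v n.+1 = y]) =
     (P x history * P (w n) [set v | v 1%N = y])%E).

Definition discount_function (R : realType) (delta : nat -> R) : Prop :=
  [/\ delta 0%N = 1,
      forall t, 0 <= delta t <= 1,
      forall s t, (s < t)%N -> delta t < delta s &
      forall s t, delta s * delta t <= delta (s + t)%N].

Section conditional_expectation.
Context {d : measure_display} {T : measurableType d} {R : realType}.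
Variable P : probability T R.

(* Z is a version of E[Y | G], for a sub-sigma-algebra G. *)
Definition is_condexp (G : set (set T)) (Y Z : T -> R) : Prop :=
  [/\ forall B, measurable B -> G (Z @^-1` B),
      P.-integrable [set: T] (EFin \o Z) &
      forall A, G A -> (\int[P]_(w in A) (Z w)%:E = \int[P]_(w in A) (Y w)%:E)%E].

Definition supermartingale (F : nat -> set (set T)) (Y : nat -> T -> R) : Prop :=
  [/\ forall t B, measurable B -> F t (Y t @^-1` B),
      forall t, P.-integrable [set: T] (EFin \o Y t) &
      forall s t, (s <= t)%N ->
        exists2 Z, is_condexp (F s) (Y t) Z & {ae P, forall w, Z w <= Y s w}].

End conditional_expectation.

Section dynkin_game.
Context {R : realType} {X : pointedFinType}.

(* Random times take values in option nat, None standing for +oo. *)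
Definition random_time := trajectory X -> option nat.

Definition first_visit_from (k : nat) (S : set X) : random_time := fun w =>
  if pselect (exists t, (k <= t)%N && (w t \in S)) is left visits
  then Some (ex_minn visits) else None.

Definition rho (S : set X) : random_time := first_visit_from 0 S.
Definition rho_plus (S : set X) : random_time := first_visit_from 1 S.

(* tau belongs to the player whose payoffs these are, sigma to the opponent. *)
Definition payoff (delta : nat -> R) (f g h : X -> R) (tau sigma : random_time)
    (w : trajectory X) : \bar R :=
  match tau w, sigma w with
  | Some s, Some t =>
      if (s < t)%N then (delta s * f (w s))%:E
      else if (t < s)%N then (delta t * g (w t))%:E
      else (delta s * h (w s))%:E
  | Some s, None => (delta s * f (w s))%:E
  | None, Some t => (delta t * g (w t))%:E
  | None, None => limn_esup (fun t => (delta t * h (w t))%:E)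
  end.

Variable P : X -> probability (trajectory X) R.

Definition expected_payoff (delta : nat -> R) (f g h : X -> R) (x : X)
    (tau sigma : random_time) : \bar R :=
  (\int[P x]_w payoff delta f g h tau sigma w)%E.

Definition Theta (delta : nat -> R) (f g h : X -> R) (T S : set X) : set X :=
  let J := expected_payoff delta f g h in
  [set x | S x /\
     (J x (fun=> Some 0%N) (rho T) >= J x (rho_plus S) (rho T))%E] `|`
  [set x | ~ S x /\
     (J x (fun=> Some 0%N) (rho T) > J x (rho_plus S) (rho T))%E].

Definition intra_equilibrium (delta : nat -> R) (f g h : X -> R)
    (T S : set X) : Prop :=
  Theta delta f g h T S = S.

Definition soft_inter_equilibrium
    (delta1 : nat -> R) (f1 g1 h1 : X -> R)
    (delta2 : nat -> R) (f2 g2 h2 : X -> R) (S T : set X) : Prop :=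
  intra_equilibrium delta1 f1 g1 h1 T S /\
  intra_equilibrium delta2 f2 g2 h2 S T.

(* The condition on (delta, g) for one player: from every starting state x,
   (delta(t) g(X_t)) is a supermartingale under P x. *)
Definition discounted_supermartingale (delta : nat -> R) (g : X -> R) : Prop :=
  forall x, supermartingale (P x) (@natural_filtration X)
    (fun t (w : trajectory X) => delta t * g (w t)).

End dynkin_game.

(* Main.v *)
(** Large payoffs force the two stopping sets into a cycle of mutual deviations.
    Since [g > h], no state lies in both [S] and [T]. Player 2 cannot leave [c]
    unstopped, waiting there being worth at most [delta2 1 * (M^2 + 1) < M^2];
    Player 1 does not stop at [c], as with positive probability the next state
    is [a] or [b] and ends the game with a reward at least [M], so [c \in T],
    and then Player 2 does not stop at [b]. If [a \in T], Player 1 waits at [b] for the reward [M^2] at [a], but then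
    Player 2 prefers to reach [c] from [a] through [b]. If [a \notin T],
    Player 1 has nothing to wait for at [b], so [b \in S]; then Player 1 does
    not stop at [a], and Player 2 must wait at [a]. But [c] cannot be reached
    from [a] without first meeting [b], where Player 1 stops, so that waiting
    is worth less than stopping at [a].

    The payoffs are never shown to be measurable: the integral of a nonnegative
    function is a supremum over simple functions below it, which gives the
    required bounds for arbitrary functions. *)
Require Import Defs.
From mathcomp Require Import all_boot all_order all_algebra.
From mathcomp Require Import all_classical all_reals all_analysis.
From mathcomp Require Import measurable_realfun lra.
Import Order.TTheory GRing.Theory Num.Theory.
Import HBNNSimple.
Set Implicit Arguments.
Unset Strict Implicit.
Unset Printing Implicit Defensive.
Local Open Scope classical_set_scope.
Local Open Scope ring_scope.

(** * Integral bounds that do not need measurable integrands *)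

(** The negative part only lowers the integral. Each simple function below the positive part is
    measurable and almost everywhere at most [v], so monotonicity is applied to it rather than to
    [f]. *)
Lemma integral_le_ae_bound d (T : measurableType d) (R : realType)
    (mu : probability T R) (f : T -> \bar R) (v : R) (A : set T) :
  0 <= v -> {ae mu, forall w, A w} -> (forall w, A w -> f w <= v%:E)%E ->
  (\int[mu]_w f w <= v%:E)%E.
Proof.
move=> v0 aeA fv; have v0E : (0 <= v%:E)%E by rewrite lee_fin.
rewrite integralE; apply: (@le_trans _ _ (\int[mu]_w f^\+ w)%E).
  by rewrite geeDl// oppe_le0; apply: integral_ge0.
rewrite ge0_integralTE//; apply: ge_ereal_sup => _ [h /= hf <-].
have -> : sintegral mu h = (\int[mu]_w (h w)%:E)%E.
  by rewrite integral_nnsfun// patch_setT.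
have -> : v%:E = (\int[mu]_w (cst v%:E) w)%E.
  by rewrite integral_cst//= probability_setT mule1.
apply: ae_ge0_le_integral => //.
- by move=> w _; rewrite lee_fin.
- exact/measurable_EFinP.
- apply: filterS aeA => w Aw _; apply: le_trans (hf w) _.
  by rewrite funeposE ge_max fv.
Qed.

Lemma ae_and d (T : measurableType d) (R : realType)
    (mu : {measure set T -> \bar R}) (A B : set T) :
  {ae mu, forall w, A w} -> {ae mu, forall w, B w} ->
  {ae mu, forall w, A w /\ B w}.
Proof. exact: filterI. Qed.

(** The simple function equal to [v] on [E] and 0 elsewhere lies below [f]. *)
Lemma le_integral_event d (T : measurableType d) (R : realType)
    (mu : {measure set T -> \bar R}) (f : T -> \bar R) (E : set T) (v : R) :
  measurable E -> 0 <= v -> (forall w, 0 <= f w)%E ->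
  (forall w, E w -> v%:E <= f w)%E -> (v%:E * mu E <= \int[mu]_w f w)%E.
Proof.
move=> mE v0 f0 vf; rewrite ge0_integralTE//; apply: ereal_sup_ubound.
exists (scale_nnsfun (indic_nnsfun R mE) v0) => [w /=|].
  rewrite /= mindicE; case: (boolP (w \in E)) => [|_].
    by rewrite mulr1 in_setE => /vf.
  by rewrite mulr0.
by rewrite sintegralrM sintegral_indic.
Qed.

(** Index 0 is left out because the intended bounds carry the factor [delta 1], which fails to
    dominate [delta 0 = 1]. *)
Lemma limn_esup_le (R : realType) (u : nat -> \bar R) (v : \bar R) :
  (forall t, (0 < t)%N -> u t <= v)%E -> (limn_esup u <= v)%E.
Proof.
move=> uv; apply: ge_ereal_inf.
exists (ereal_sup (u @` [set t | (0 < t)%N])).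
  by exists [set t | (0 < t)%N] => //; exists 1%N.
by apply: ge_ereal_sup => _ [t t0 <-]; apply: uv.
Qed.

(** * First visit times *)

Section random_times.
Context {X : pointedFinType}.
Implicit Types (S : set X) (w : trajectory X).

Variant first_visit_spec k S w : option nat -> Prop :=
| FirstVisitSome t of (k <= t)%N & S (w t) &
    (forall s, (k <= s < t)%N -> ~ S (w s)) : first_visit_spec k S w (Some t)
| FirstVisitNone of (forall t, (k <= t)%N -> ~ S (w t)) :
    first_visit_spec k S w None.

Lemma first_visitP k S w : first_visit_spec k S w (first_visit_from k S w).
Proof.
rewrite /first_visit_from; case: pselect => [ex|nex].
  case: ex_minnP => t /andP[kt /set_mem St] tmin; constructor => // s.
  move=> /andP[ks st] Ss; have := tmin s; rewrite ks mem_set//= => /(_ isT).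
  by rewrite leqNgt st.
constructor => t kt St; apply: nex; exists t.
by rewrite kt mem_set.
Qed.

Lemma first_visit_fromE k S w t : (k <= t)%N -> S (w t) ->
  (forall s, (k <= s < t)%N -> ~ S (w s)) -> first_visit_from k S w = Some t.
Proof.
move=> kt St nS; case: first_visitP => [s ks Ss nSs|/(_ t kt)//].
have [st|ts|->//] := ltngtP s t.
  by have := nS s; rewrite ks st => /(_ isT).
by have := nSs t; rewrite kt ts => /(_ isT).
Qed.

End random_times.

(** * Histories, transitions and almost sure visits of the chain *)

Section markov_chains.
Context {R : realType} {X : pointedFinType}.
Implicit Types (x y z : X) (D : set X) (n : nat).

Lemma measurable_coordinate n D :
  measurable ([set w | D (w n)] : set (trajectory X)).
Proof.
have -> : [set w | D (w n)] = \bigcup_(x in D) [set w : nat -> X | w n = x].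
  by apply/seteqP; split => [w Dw|w [x Dx /= ->]//]; exists (w n).
apply: fin_bigcup_measurable => [|x _]; first exact: finite_finset.
by apply: sub_sigma_algebra; exists n => //; exists x.
Qed.

Lemma measurable_before n D :
  measurable ([set w | forall k, (k <= n)%N -> D (w k)] : set (trajectory X)).
Proof.
have -> : [set w | forall k, (k <= n)%N -> D (w k)] =
    \bigcap_(k in [set k | (k <= n)%N]) [set w : nat -> X | D (w k)].
  by apply/seteqP; split => w.
by apply: bigcap_measurable => [|k _]; [exists 0%N|exact: measurable_coordinate].
Qed.

Lemma measurable_history n (v : nat -> X) :
  measurable ([set w | forall k, (k <= n)%N -> w k = v k] : set (trajectory X)).
Proof.
have -> : [set w | forall k, (k <= n)%N -> w k = v k] =
    \bigcap_(k in [set k | (k <= n)%N]) [set w : nat -> X | [set v k] (w k)].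
  by apply/seteqP; split => w.
by apply: bigcap_measurable => [|k _]; [exists 0%N|exact: measurable_coordinate].
Qed.

(** Histories up to time [n] are the fibres of a map to a finite type, hence a finite partition.
    This transfers the Markov property from single histories to events. *)
Lemma sum_histories (mu : probability (trajectory X) R) n
    (F : set (trajectory X)) : measurable F ->
  (mu F = \sum_(u \in [set: {ffun 'I_n.+1 -> X}])
    mu (F `&` [set w | forall k, (k <= n)%N -> w k = u (inord k)]))%E.
Proof.
move=> mF.
pose H (u : {ffun 'I_n.+1 -> X}) : set (trajectory X) :=
  [set w | forall k, (k <= n)%N -> w k = u (inord k)].
rewrite -[RHS]/(\sum_(u \in [set: {ffun 'I_n.+1 -> X}]) mu (F `&` H u))%E.
have HE u : H u = (fun w : nat -> X => [ffun k : 'I_n.+1 => w k]) @^-1` [set u].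
  apply/seteqP; split => w /= => [Hw|<- k kn]; last by rewrite ffunE inordK.
  by apply/ffunP => k; rewrite ffunE Hw ?inord_val// -ltnS.
rewrite -measure_fin_bigcup//=.
- rewrite -setI_bigcupr [X in F `&` X](_ : _ = setT) ?setIT//.
  by apply/seteqP; split => // w _; exists [ffun k : 'I_n.+1 => w k] => //; rewrite HE.
- by apply: trivIset_setIl; rewrite (funext HE); exact: trivIset_preimage1.
- move=> u _; apply: measurableI => //.
  exact: (@measurable_history n (fun k => u (inord k))).
Qed.

Variable P : X -> probability (trajectory X) R.
Hypothesis P_markov : markov_chain P.

Lemma markov_start x : {ae P x, forall w, w 0%N = x}.
Proof.
exists (~` [set w | w 0%N = x]); split => //.
- by apply: measurableC; exact: (measurable_coordinate 0 [set x]).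
- rewrite probability_setC; last exact: (measurable_coordinate 0 [set x]).
  by rewrite P_markov.1 subee.
Qed.

(** An event determined by the coordinates up to [n] either contains a given history or misses it.
    The contained histories all end in [y], so the Markov property gives them the same factor, and
    the sum recombines. *)
Lemma markov_step x n y z (E : set (trajectory X)) :
  measurable E ->
  (forall v w : nat -> X, (forall k, (k <= n)%N -> v k = w k) -> E v -> E w) ->
  (forall w, E w -> w n = y) ->
  P x (E `&` [set w | w n.+1 = z]) = (P x E * P y [set w | w 1%N = z])%E.
Proof.
move=> mE detE Ey.
rewrite (sum_histories _ n mE) (sum_histories _ n); last first.
  by apply: measurableI => //; exact: (measurable_coordinate n.+1 [set z]).
rewrite ge0_mule_fsuml//; apply: eq_fsbigr => u _.
pose v k := u (inord k).
set H := [set w | forall k, (k <= n)%N -> w k = v k].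
rewrite -/H.
have [Ev|nEv] := pselect (E v).
  have -> : E `&` H = H.
    by apply/setIidr => w Hw; apply: detE Ev => k kn; rewrite Hw.
  have -> : E `&` [set w | w n.+1 = z] `&` H = H `&` [set w | w n.+1 = z].
    apply/seteqP; split => w; first by case=> -[? ?] ?; split.
    by move=> [Hw wz]; split => //; split => //; apply: detE Ev => k kn; rewrite Hw.
  by have := P_markov.2 x n v z; rewrite (Ey _ Ev).
have EH0 : E `&` H = set0.
  by apply/seteqP; split => // w [Ew Hw]; apply: nEv; apply: detE Ew.
by rewrite setIAC EH0 set0I !measure0 mul0e.
Qed.

Lemma markov_step_eq x n y z :
  P x [set w | w n = y /\ w n.+1 = z] =
  (P x [set w | w n = y] * P y [set w | w 1%N = z])%E.
Proof.
apply: markov_step => //; first exact: (measurable_coordinate n [set y]).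
by move=> v w vw /= <-; rewrite vw.
Qed.

Lemma ae_no_null_transition x y z : P y [set w | w 1%N = z] = 0%E ->
  {ae P x, forall w, forall n, w n = y -> w n.+1 <> z}.
Proof.
move=> Pyz; apply: ae_foralln => n.
exists [set w | w n = y /\ w n.+1 = z]; split.
- apply: measurableI; first exact: (measurable_coordinate n [set y]).
  exact: (measurable_coordinate n.+1 [set z]).
- by have := markov_step_eq x n y z; rewrite Pyz mule0.
- by move=> w /= /not_implyP[wy /contrapT wz].
Qed.

(* A chain avoiding [c] is at [b] at time [n] or [n.+1] with probability at
   least [P_ab] times the probability of avoiding [c] up to time [n], and then
   it enters [c] with probability [P_bc]: the avoidance probability drops every
   two steps by at least its limit times [P_ab P_bc]. *)
Lemma ae_visits x a b c : b != c ->
  (forall y, y \in [:: a; b; c]) ->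
  (0 < P a [set w | w 1%N = b])%E -> (0 < P b [set w | w 1%N = c])%E ->
  {ae P x, forall w, exists n, w n = c}.
Proof.
move=> bc Xabc Pab0 Pbc0.
pose A n := [set w : trajectory X | forall k, (k <= n)%N -> w k <> c].
pose q y z := fine (P y [set w | w 1%N = z]).
pose p n y := fine (P x (A n `&` [set w | w n = y])).
pose s n := fine (P x (A n)).
pose N := [set w : trajectory X | forall n, w n <> c].
have mA n : measurable (A n) := measurable_before n (~` [set c]).
have mc n y : measurable ([set w | w n = y] : set (trajectory X)).
  exact: (measurable_coordinate n [set y]).
have mAc n y : measurable (A n `&` [set w | w n = y]) by exact: measurableI.
have fP y B : measurable B -> P y B \is a fin_num by exact: fin_num_measure.
have mono B C : measurable B -> measurable C -> B `<=` C ->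
    fine (P x B) <= fine (P x C).
  by move=> mB mC BC; apply: fine_le; rewrite ?fP// le_measure// inE.
have mN : measurable N.
  have -> : N = \bigcap_n A n.
    by apply/seteqP; split => w => [Nw n _ k _|Aw n]; [exact: Nw|exact: (Aw n)].
  exact: bigcap_measurable.
have qab : 0 < q a b by rewrite fine_gt0// Pab0 ltey_eq fP.
have qbc : 0 < q b c by rewrite fine_gt0// Pbc0 ltey_eq fP.
have qab1 : q a b <= 1.
  by rewrite -lee_fin fineK ?fP// probability_le1.
have step n y z : fine (P x (A n `&` [set w | w n = y] `&` [set w | w n.+1 = z]))
    = p n y * q y z.
  rewrite (@markov_step x n y z)//; first by rewrite fineM ?fP.
  - move=> v w vw [Av vy]; split => [k kn|]; first by rewrite -vw//; exact: Av.
    by move: vy; rewrite /= vw.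
  - by move=> w [].
have sp n : s n <= p n a + p n b.
  rewrite -fineD ?fP//; apply: fine_le; rewrite ?fin_numD ?fP//.
  apply: (@le_trans _ _ (P x ((A n `&` [set w | w n = a]) `|`
                              (A n `&` [set w | w n = b])))); last exact: measureU2.
  rewrite le_measure ?inE//; first exact: measurableU.
  move=> w Aw; have := Xabc (w n); rewrite !inE => /or3P[] /eqP wn; [by left|by right|].
  by have := Aw n (leqnn n).
have pab n : p n a * q a b <= p n.+1 b.
  rewrite -step; apply: mono => //; first exact: measurableI.
  move=> w [[Aw wa] wb]; split => // k; rewrite leq_eqVlt ltnS => /orP[/eqP->|/Aw//].
  by rewrite wb; apply/eqP.
have pbc n : p n b * q b c <= s n - s n.+1.
  rewrite -step lerBrDr -fineD ?fP//; last exact: measurableI.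
  rewrite -measureU//; last 2 first.
  - exact: measurableI.
  - by apply/seteqP; split => // w [[_ wc] /(_ n.+1 (leqnn _))].
  apply: mono => //; first by apply: measurableU => //; exact: measurableI.
  by move=> w [[[]]//|Aw k kn]; apply: Aw; exact: leqW.
pose L := fine (P x N).
have Ls n : L <= s n by apply: mono => // w Nw k _.
have s_drop m : s m.*2 <= 1 - m%:R * (L * q a b * q b c).
  elim: m => [|m IHm].
    by rewrite mul0r subr0 /s -lee_fin fineK ?fP// probability_le1.
  have L_p : L * q a b <= p m.*2.+1 b + p m.*2 b.
    apply: le_trans (ler_wpM2r (ltW qab) (le_trans (Ls m.*2) (sp m.*2))) _.
    rewrite mulrDl lerD// ler_piMr// fine_ge0//.
  have := ler_wpM2r (ltW qbc) L_p; have := pbc m.*2; have := pbc m.*2.+1.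
  rewrite doubleS -natr1 => *; lra.
have L0 : L = 0.
  apply/eqP; rewrite eq_le fine_ge0// andbT leNgt; apply/negP => L_gt0.
  (* Were [L] positive, an integer [m] above the inverse of this product would make the bound of
     [s_drop] negative, although it dominates [L]. *)
  have e_gt0 : 0 < L * q a b * q b c by rewrite !mulr_gt0.
  have := truncnS_gt (L * q a b * q b c)^-1; rewrite ltNge => /negP; apply.
  rewrite -[leRHS]mul1r ler_pdivlMr// -subr_ge0.
  by apply: le_trans (s_drop _); apply: le_trans (Ls _); exact: ltW.
exists N; split => //; first by rewrite -[LHS]fineK ?fP// -/L L0.
by move=> w /= nw n wc; apply: nw; exists n.
Qed.

End markov_chains.

(** * Bounds on the values of stopping and of waiting *)

Section stopping_game.
Context {R : realType} {X : pointedFinType}.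
Variable P : X -> probability (trajectory X) R.
Hypothesis P_markov : markov_chain P.
Variables (delta : nat -> R) (f g h : X -> R).
Hypothesis delta_discount : discount_function delta.
Hypotheses (f_ge0 : forall x, 0 <= f x) (g_ge0 : forall x, 0 <= g x)
  (h_ge0 : forall x, 0 <= h x).
Implicit Types (S T : set X) (x y z : X) (w : trajectory X).

Local Notation q x y := (fine (P x [set w | w 1%N = y])).
Local Notation J := (expected_payoff P delta f g h).

Lemma discount_ge0 n : 0 <= delta n.
Proof. by case: delta_discount => _ /(_ n) /andP[]. Qed.

Lemma discount_le1 n : delta n <= 1.
Proof. by case: delta_discount => _ /(_ n) /andP[]. Qed.

Lemma discount_gt0 n : 0 < delta n.
Proof.
case: delta_discount => _ _ /(_ n n.+1 (ltnSn n)) + _.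
exact/le_lt_trans/discount_ge0.
Qed.

Lemma discount_lt1 : delta 1%N < 1.
Proof. by case: delta_discount => <- _ + _; apply. Qed.

Lemma discount_anti n : (0 < n)%N -> delta n <= delta 1%N.
Proof.
case: delta_discount => _ _ dec _; rewrite leq_eqVlt => /orP[/eqP<-//|/dec].
exact: ltW.
Qed.

Lemma transition_fineK x y : (q x y)%:E = P x [set w | w 1%N = y].
Proof.
by rewrite fineK// fin_num_measure//; exact: (@measurable_coordinate X 1 [set y]).
Qed.

Lemma payoff_ge0 tau sigma w : (0 <= payoff delta f g h tau sigma w)%E.
Proof.
have pos n k y : (forall x, 0 <= k x) -> (0 <= (delta n * k y)%:E)%E.
  by move=> k0; rewrite lee_fin mulr_ge0 ?discount_ge0.
rewrite /payoff; case: (tau w) => [s|]; case: (sigma w) => [t|]; rewrite ?pos//.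
  by do 2?case: ifP => _; rewrite pos.
by apply: limf_esup_ge0 => [|t]; [exact: filter_not_empty|exact: pos].
Qed.

(** A waiting player cannot stop before time 1, whereas the opponent may stop at time 0; hence only
    [PayoffOther] allows [n = 0]. *)
Variant payoff_spec S T w : \bar R -> Prop :=
| PayoffOwn n of (0 < n)%N & S (w n) & (forall s, (0 < s < n)%N -> ~ S (w s)) &
    (forall s, (s <= n)%N -> ~ T (w s)) :
    payoff_spec S T w (delta n * f (w n))%:E
| PayoffOther n of T (w n) & (forall s, (s < n)%N -> ~ T (w s)) &
    (forall s, (0 < s <= n)%N -> ~ S (w s)) :
    payoff_spec S T w (delta n * g (w n))%:E
| PayoffTie n of (0 < n)%N & S (w n) & T (w n) &
    (forall s, (s < n)%N -> ~ T (w s)) :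
    payoff_spec S T w (delta n * h (w n))%:E
| PayoffNever of (forall s, (0 < s)%N -> ~ S (w s)) & (forall s, ~ T (w s)) :
    payoff_spec S T w (limn_esup (fun t => (delta t * h (w t))%:E)).

Lemma payoffP S T w :
  payoff_spec S T w (payoff delta f g h (rho_plus S) (rho T) w).
Proof.
rewrite /payoff /rho_plus /rho.
case: first_visitP => [n n0 Sn nS|nS]; case: first_visitP => [m _ Tm nT|nT].
- have [nm|mn|nm] := ltngtP n m.
  + by apply: PayoffOwn => // s sn; apply: nT; exact: leq_ltn_trans sn nm.
  + apply: PayoffOther => // s /andP[s0 sm]; apply: nS.
    by rewrite s0 (leq_ltn_trans sm mn).
  + by apply: PayoffTie => //; rewrite nm.
- by apply: PayoffOwn => // s _; exact: nT.
- by apply: PayoffOther => // s /andP[s0 _]; exact: nS.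
- by apply: PayoffNever => // s; exact: nT.
Qed.

Lemma payoff_stop_now T w :
  payoff delta f g h (fun=> Some 0%N) (rho T) w =
  ((if pselect (T (w 0%N)) then h else f) (w 0%N))%:E.
Proof.
have d0 : delta 0%N = 1 by case: delta_discount.
rewrite /payoff /rho; case: first_visitP => [n _ Tn nT|nT].
  case: n Tn nT => [|n] Tn nT; case: pselect => //=; rewrite d0 mul1r// => T0.
  by have := nT 0%N isT T0.
by case: pselect => T0; [case: (nT 0%N isT T0)|rewrite d0 mul1r].
Qed.

Lemma payoff_own S T w n : (0 < n)%N -> S (w n) ->
  (forall s, (0 < s < n)%N -> ~ S (w s)) -> (forall s, (s <= n)%N -> ~ T (w s)) ->
  payoff delta f g h (rho_plus S) (rho T) w = (delta n * f (w n))%:E.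
Proof.
move=> n0 Sn nS nT; rewrite /payoff /rho_plus (first_visit_fromE n0 Sn nS) /rho.
by case: first_visitP => // m _ Tm _; case: ltnP => // /nT.
Qed.

Lemma payoff_other S T w n : T (w n) -> (forall s, (s < n)%N -> ~ T (w s)) ->
  (forall s, (0 < s <= n)%N -> ~ S (w s)) ->
  payoff delta f g h (rho_plus S) (rho T) w = (delta n * g (w n))%:E.
Proof.
move=> Tn nT nS; rewrite /payoff /rho (first_visit_fromE (leq0n n) Tn); last first.
  by move=> s; exact: nT.
rewrite /rho_plus; case: first_visitP => // m m0 Sm _.
case: ltngtP => [mn|//|mn]; first by have := nS m; rewrite m0 (ltnW mn) => /(_ isT).
by have := nS m; rewrite m0 -mn leqnn => /(_ isT).
Qed.

Lemma stop_now_le x T :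
  (J x (fun=> Some 0%N) (rho T) <= ((if pselect (T x) then h else f) x)%:E)%E.
Proof.
apply: (integral_le_ae_bound _ (markov_start P_markov x)) => [|w w0].
  by case: pselect.
by rewrite payoff_stop_now w0.
Qed.

Lemma le_stop_now x T : ~ T x -> ((f x)%:E <= J x (fun=> Some 0%N) (rho T))%E.
Proof.
move=> Tx; rewrite -[leLHS]mule1 -(P_markov.1 x).
apply: le_integral_event => [|//|w|w /= w0].
- exact: (measurable_coordinate 0 [set x]).
- exact: payoff_ge0.
- by rewrite payoff_stop_now w0; case: pselect.
Qed.

(** The opponent stops at time 0, before the waiting player can, so [g x] is paid undiscounted. *)
Lemma wait_in_other_ge x S T : T x -> ((g x)%:E <= J x (rho_plus S) (rho T))%E.
Proof.
move=> Tx; rewrite -[leLHS]mule1 -(P_markov.1 x).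
apply: le_integral_event => [|//|w|w /= w0].
- exact: (measurable_coordinate 0 [set x]).
- exact: payoff_ge0.
- have d0 : delta 0%N = 1 by case: delta_discount.
  case: payoffP => [n _ _ _ nT|[|n] _ nT _|n n0 _ _ nT|_ nT].
  + by have := nT 0%N isT; rewrite w0.
  + by rewrite d0 mul1r w0.
  + by have := nT 0%N isT; rewrite w0.
  + by have := nT 0%N n0; rewrite w0.
  + by have := nT 0%N; rewrite w0.
Qed.

(** Neither player stops at time 0, so every payoff is discounted by at least one step; the limit
    superior of an endless play obeys the same bound. *)
Lemma wait_le x S T (C : R) : 0 <= C -> ~ T x ->
  (forall y, [/\ f y <= C, g y <= C & h y <= C]) ->
  (J x (rho_plus S) (rho T) <= (delta 1%N * C)%:E)%E.
Proof.
move=> C0 Tx ubC.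
have bound n k y : (0 < n)%N -> 0 <= k y -> k y <= C ->
    ((delta n * k y)%:E <= (delta 1%N * C)%:E)%E.
  by move=> n0 k0 kC; rewrite lee_fin ler_pM ?discount_ge0 ?discount_anti.
apply: (integral_le_ae_bound _ (markov_start P_markov x)) => [|w w0].
  by rewrite mulr_ge0 ?discount_ge0.
case: payoffP => [n n0 _ _ _|n Tn _ _|n n0 _ _ _|_ _].
- by apply: bound => //; case: (ubC (w n)).
- apply: bound => //; last by case: (ubC (w n)).
  by case: n Tn => //; rewrite w0.
- by apply: bound => //; case: (ubC (w n)).
- by apply: limn_esup_le => t t0; apply: bound => //; case: (ubC (w t)).
Qed.

(** Only the paths moving from [x] to [y] are counted. Exactly one player stops at [y], so there is
    no tie. *)
Lemma wait_ge_one_step x y S T (v : R) : 0 <= v -> ~ T x -> (S y -> ~ T y) ->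
  (S y /\ v <= f y) \/ (T y /\ v <= g y) ->
  ((delta 1%N * v * q x y)%:E <= J x (rho_plus S) (rho T))%E.
Proof.
move=> v0 Tx ST y_stop.
pose E := [set w : trajectory X | w 0%N = x /\ w 1%N = y].
have mE : measurable E.
  apply: measurableI; first exact: (measurable_coordinate 0 [set x]).
  exact: (measurable_coordinate 1 [set y]).
have -> : ((delta 1%N * v * q x y)%:E = (delta 1%N * v)%:E * P x E)%E.
  by rewrite EFinM transition_fineK markov_step_eq// P_markov.1 mul1e.
apply: le_integral_event => [//||w|w [w0 w1]].
- by rewrite mulr_ge0 ?discount_ge0.
- exact: payoff_ge0.
case: y_stop => [[Sy vf]|[Ty vg]].
- rewrite (@payoff_own _ _ _ 1) ?w1//.
  + by rewrite lee_fin ler_wpM2l ?discount_ge0.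
  + by case.
  + by case=> [|[|//]]; rewrite ?w0 ?w1// => _; exact: ST.
- rewrite (@payoff_other _ _ _ 1) ?w1//.
  + by rewrite lee_fin ler_wpM2l ?discount_ge0.
  + by case=> // _; rewrite w0.
  + by case=> [//|[|//]]; rewrite w1 => _ /ST.
Qed.

(** Only the paths through [x], [y], [z] are counted: nobody stops at [y], and the waiting player
    alone stops at [z]. *)
Lemma wait_ge_two_steps x y z S T (v : R) : 0 <= v -> ~ T x ->
  ~ S y -> ~ T y -> S z -> ~ T z -> v <= f z ->
  ((delta 2%N * v * (q x y * q y z))%:E <= J x (rho_plus S) (rho T))%E.
Proof.
move=> v0 Tx Sy Ty Sz Tz vf.
pose E0 := [set w : trajectory X | w 0%N = x /\ w 1%N = y].
have mE0 : measurable E0.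
  apply: measurableI; first exact: (measurable_coordinate 0 [set x]).
  exact: (measurable_coordinate 1 [set y]).
pose E := E0 `&` [set w : trajectory X | w 2%N = z].
have mE : measurable E.
  by apply: measurableI => //; exact: (measurable_coordinate 2 [set z]).
have PE : P x E = (P x [set w | w 1%N = y] * P y [set w | w 1%N = z])%E.
  rewrite (@markov_step _ _ _ P_markov x 1 y z)//; last by move=> w [].
    by rewrite markov_step_eq// P_markov.1 mul1e.
  by move=> v1 v2 v12 [? ?]; split; rewrite -v12.
have -> : ((delta 2%N * v * (q x y * q y z))%:E = (delta 2%N * v)%:E * P x E)%E.
  by rewrite EFinM [X in (_ * X)%E]EFinM !transition_fineK PE.
apply: le_integral_event => [//||w|w [[w0 w1] w2]].
- by rewrite mulr_ge0 ?discount_ge0.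
- exact: payoff_ge0.
rewrite (@payoff_own _ _ _ 2) ?w2//.
- by rewrite lee_fin ler_wpM2l ?discount_ge0.
- by case=> [//|[|//]]; rewrite w1.
- by case=> [|[|[|//]]]; rewrite ?w0 ?w1 ?w2.
Qed.

(** Someone stops at [c], so the almost sure visit excludes endless play, and disjointness excludes
    ties. Since [x != c], the visit has positive time and counts for [rho_plus]. *)
Lemma wait_le_visits x c S T (C : R) : 0 <= C -> x != c ->
  {ae P x, forall w, exists n, w n = c} -> S c \/ T c ->
  (forall y, S y -> ~ T y) ->
  (forall y, S y -> f y <= C) -> (forall y, T y -> g y <= C) ->
  (J x (rho_plus S) (rho T) <= C%:E)%E.
Proof.
move=> C0 xc c_visited c_stop ST fC gC.
have bound n (r : R) : 0 <= r -> r <= C -> ((delta n * r)%:E <= C%:E)%E.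
  move=> r0 rC; rewrite lee_fin; apply: le_trans rC.
  by rewrite ler_piMl// discount_le1.
apply: (integral_le_ae_bound _ (ae_and (markov_start P_markov x) c_visited)) => //.
move=> w [w0 [m wm]].
case: payoffP => [n _ Sn _ _|n Tn _ _|n _ Sn Tn _|nS nT].
- by apply: bound => //; exact: fC.
- by apply: bound => //; exact: gC.
- by case: (ST _ Sn).
have m0 : (0 < m)%N by rewrite lt0n; apply: contraNneq xc => m0; rewrite -w0 -wm m0.
by case: c_stop; rewrite -wm; [move/(nS m m0)|move/(nT m)].
Qed.

(** Before meeting [T] the chain stays at [x], from which it can only move to [b], a point of [T].
    The waiting player thus never stops first or ties: either the opponent's stop pays [g], or the
    path is constant and pays at most [delta 1 * h x]. *)
Lemma wait_le_barrier x b c S T (C : R) : 0 <= C ->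
  (forall y, y \in [:: x; b; c]) -> P x [set w | w 1%N = c] = 0%E ->
  ~ S x -> ~ S b -> ~ T x -> T b ->
  (forall y, T y -> g y <= C) -> delta 1%N * h x <= C ->
  (J x (rho_plus S) (rho T) <= C%:E)%E.
Proof.
move=> C0 Xxbc Pxc Sx Sb Tx Tb gC hC.
apply: (integral_le_ae_bound C0
  (ae_and (markov_start P_markov x) (ae_no_null_transition P_markov x Pxc))).
move=> w [w0 noxc].
have next n : w n = x -> w n.+1 = x \/ w n.+1 = b.
  move=> wn; have := Xxbc (w n.+1); rewrite !inE => /or3P[] /eqP; [by left|by right|].
  by move/(noxc n wn).
have stay n : (forall s, (s <= n)%N -> ~ T (w s)) -> w n = x.
  elim: n => // n IHn nT.
  have /next[//|wb] : w n = x by apply: IHn => s sn; apply: nT; exact: leqW.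
  by case: (nT n.+1 (leqnn _)); rewrite wb.
case: payoffP => [n _ Sn _ nT|n Tn _ _|[//|n] n0 Sn Tn nT|_ nT].
- by case: Sx; rewrite -(stay n nT).
- rewrite lee_fin; apply: le_trans (gC _ Tn).
  by rewrite ler_piMl// discount_le1.
- have [wx|wb] := next n (stay n nT); first by case: Sx; rewrite -wx.
  by case: Sb; rewrite -wb.
- apply: limn_esup_le => t t0; rewrite lee_fin; apply: le_trans hC.
  by rewrite stay// ler_wpM2r// discount_anti.
Qed.

(** * Consequences of the fixed point condition *)

Lemma equilibrium_stop S T x :
  intra_equilibrium P delta f g h T S -> S x ->
  (J x (rho_plus S) (rho T) <= J x (fun=> Some 0%N) (rho T))%E.
Proof. by move=> ST; rewrite -{1}ST => -[[]//|[nSx]]; exact: ltW. Qed.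

Lemma equilibrium_continue S T x :
  intra_equilibrium P delta f g h T S -> ~ S x ->
  (J x (fun=> Some 0%N) (rho T) <= J x (rho_plus S) (rho T))%E.
Proof.
by move=> ST nSx; rewrite leNgt; apply/negP => lt; apply: (nSx); rewrite -ST; right.
Qed.

(** At a common point stopping yields the tie reward [h x], while waiting one instant yields at
    least [g x]. *)
Lemma equilibrium_disjoint S T x : h x < g x ->
  intra_equilibrium P delta f g h T S -> S x -> ~ T x.
Proof.
move=> hg ST Sx Tx; have := equilibrium_stop ST Sx; apply/negP; rewrite -ltNge.
apply: lt_le_trans (wait_in_other_ge S Tx); apply: le_lt_trans (stop_now_le x T) _.
by case: pselect => /= Tx'; rewrite lte_fin.
Qed.

Lemma equilibrium_wait_le S T x : intra_equilibrium P delta f g h T S ->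
  S x -> ~ T x -> (J x (rho_plus S) (rho T) <= (f x)%:E)%E.
Proof.
move=> ST Sx Tx; apply: le_trans (equilibrium_stop ST Sx) _.
by apply: le_trans (stop_now_le x T) _; case: pselect.
Qed.

Lemma equilibrium_wait_ge S T x : intra_equilibrium P delta f g h T S ->
  ~ S x -> ~ T x -> ((f x)%:E <= J x (rho_plus S) (rho T))%E.
Proof.
by move=> ST Sx Tx; apply: le_trans (le_stop_now Tx) (equilibrium_continue ST Sx).
Qed.

End stopping_game.

(** * The threshold for [M] and the supermartingale condition *)

Lemma eventually_large_multiples (R : realType) (ks : seq R) :
  (forall k, k \in ks -> 0 < k) ->
  exists2 M0 : R, 0 < M0 &
    forall M, M0 <= M -> 3 <= M /\ forall k, k \in ks -> 2 <= k * M.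
Proof.
elim: ks => [_|k ks IHks ks0]; first by exists 3.
have [k' k'ks|M0 M0_gt0 M0P] := IHks; first by apply: ks0; rewrite inE k'ks orbT.
exists (Num.max M0 (k^-1 * 2)) => [|M]; first by rewrite lt_max M0_gt0.
rewrite ge_max => /andP[/M0P[M3 ksM] kM]; split => // k'.
rewrite inE => /predU1P[->|/ksM//].
by rewrite -ler_pdivrMl// ks0// mem_head.
Qed.

(** Between times 0 and 1, on the whole space: the integral of the conditional expectation is at
    most [g x], and it equals that of the time 1 value, which the event of moving to [y] bounds
    below. *)
Lemma discounted_supermartingale_one_step (R : realType) (X : pointedFinType)
    (P : X -> probability (trajectory X) R) (delta : nat -> R) (g : X -> R) (x y : X) :
  markov_chain P -> discount_function delta -> (forall z, 0 <= g z) ->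
  discounted_supermartingale P delta g ->
  delta 1%N * g y * fine (P x [set w | w 1%N = y]) <= g x.
Proof.
move=> P_markov delta_discount g0 /(_ x)[_ _ /(_ 0%N 1%N isT)[Z [_ _ EZ] Zle]].
have /EZ {}EZ : natural_filtration 0 ([set: nat -> X] : set (nat -> X)).
  by rewrite -(setD0 setT); apply: sigma_algebraCD; exact: sigma_algebra0.
rewrite -lee_fin EFinM transition_fineK//.
have Y1_ge : ((delta 1%N * g y)%:E * P x [set w | w 1%N = y] <=
    \int[P x]_w (delta 1%N * g (w 1%N))%:E)%E.
  apply: le_integral_event => [|||w /= ->//].
  - exact: (measurable_coordinate 1 [set y]).
  - by rewrite mulr_ge0// discount_ge0.
  - by move=> w; rewrite lee_fin mulr_ge0// discount_ge0.
apply: le_trans Y1_ge _; rewrite -EZ.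
apply: (integral_le_ae_bound _ (ae_and (markov_start P_markov x) Zle)) => //.
move=> w [w0 Zw]; rewrite lee_fin; apply: le_trans Zw _.
by rewrite w0; case: delta_discount => ->; rewrite mul1r.
Qed.

(** * The three-state game *)

Theorem proposition4p1 (R : realType) (X : pointedFinType) (a b c : X)
  (distinct_abc : uniq [:: a; b; c])
  (X_abc : forall x : X, x \in [:: a; b; c])
  (P : X -> probability (trajectory X) R)
  (P_markov : markov_chain P)
  (P_ac : P a [set w | w 1%N = c] = 0%E)
  (P_pos : forall x y : X, (x, y) <> (a, c) ->
     (0 < P x [set w | w 1%N = y])%E)
  (delta1 delta2 : nat -> R)
  (delta1_discount : discount_function delta1)
  (delta2_discount : discount_function delta2) :
  exists2 M0 : R, 0 < M0 & forall M : R, M0 <= M ->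
    forall f1 g1 h1 f2 g2 h2 : X -> R,
    f1 a = 1 -> g1 a = M ^+ 2 -> f2 a = M -> g2 a = M + 1 ->
    f1 b = M -> g1 b = M + 1 -> f2 b = 1 -> g2 b = 2 ->
    f1 c = 1 -> g1 c = 2 -> f2 c = M ^+ 2 -> g2 c = M ^+ 2 + 1 ->
    (forall x, h1 x = (f1 x + g1 x) / 2) ->
    (forall x, h2 x = (f2 x + g2 x) / 2) ->
    ~ (discounted_supermartingale P delta1 g1 /\
       discounted_supermartingale P delta2 g2) /\
    ~ (exists S T : set X,
         soft_inter_equilibrium P delta1 f1 g1 h1 delta2 f2 g2 h2 S T).
Proof.
have [ab ac bc] : [/\ a != b, a != c & b != c].
  by move: distinct_abc; rewrite /= !inE negb_or andbT => /andP[/andP[]].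
pose q x y := fine (P x [set w | w 1%N = y]).
have q_gt0 x y : (x, y) <> (a, c) -> 0 < q x y.
  by move=> xy; rewrite -lte_fin transition_fineK P_pos.
have qab : 0 < q a b by apply: q_gt0 => -[cb]; rewrite cb eqxx in bc.
have qba : 0 < q b a by apply: q_gt0 => -[ba _]; rewrite ba eqxx in ab.
have qbc : 0 < q b c by apply: q_gt0 => -[ba]; rewrite ba eqxx in ab.
have qca : 0 < q c a by apply: q_gt0 => -[ca _]; rewrite ca eqxx in ac.
have qcb : 0 < q c b by apply: q_gt0 => -[ca _]; rewrite ca eqxx in ac.
have d1 := discount_gt0 delta1_discount; have d2 := discount_gt0 delta2_discount.
have d2_lt1 := discount_lt1 delta2_discount.
(* One positive coefficient for each deviation used below. They involve only the chain and the
   discounts, so [M0] can be chosen before the payoffs. *)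
pose ks := [:: 1 - delta2 1%N; delta1 1%N * q a b; delta1 1%N * q b a;
  delta2 1%N * q b c; delta1 1%N * q c a; delta1 1%N * q c b;
  delta2 2%N * (q a b * q b c)].
have [k|M0 M0_gt0 M0P] := @eventually_large_multiples _ ks.
  rewrite /ks !inE => /or4P[|||/or4P[||| ]] /eqP->; rewrite ?subr_gt0 ?mulr_gt0//.
exists M0 => // M /M0P[M3 ksM] f1 g1 h1 f2 g2 h2.
move=> f1a g1a f2a g2a f1b g1b f2b g2b f1c g1c f2c g2c h1E h2E.
have large k : k \in ks -> 2 <= k * M /\ 2 * M <= k * M ^+ 2.
  move=> /ksM kM; split => //.
  by rewrite expr2 mulrA ler_wpM2r//; apply: le_trans M3.
have [kd kdM] := large (1 - delta2 1%N) ltac:(by rewrite !inE eqxx).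
have [kab _] := large (delta1 1%N * q a b) ltac:(by rewrite !inE eqxx ?orbT).
have [_ kba] := large (delta1 1%N * q b a) ltac:(by rewrite !inE eqxx ?orbT).
have [_ kbc] := large (delta2 1%N * q b c) ltac:(by rewrite !inE eqxx ?orbT).
have [_ kca] := large (delta1 1%N * q c a) ltac:(by rewrite !inE eqxx ?orbT).
have [kcb _] := large (delta1 1%N * q c b) ltac:(by rewrite !inE eqxx ?orbT).
have [_ kabc] := large (delta2 2%N * (q a b * q b c)) ltac:(by rewrite !inE eqxx ?orbT).
have M2_gt : M < M ^+ 2 by nra.
have Xcase (p : X -> Prop) : p a -> p b -> p c -> forall x, p x.
  by move=> pa pb pc x; have := X_abc x; rewrite !inE => /or3P[]/eqP->.
have f1_0 : forall x, 0 <= f1 x by apply: Xcase; lra.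
have g1_0 : forall x, 0 <= g1 x by apply: Xcase; lra.
have f2_0 : forall x, 0 <= f2 x by apply: Xcase; lra.
have g2_0 : forall x, 0 <= g2 x by apply: Xcase; lra.
have h1_0 x : 0 <= h1 x by rewrite h1E divr_ge0// addr_ge0.
have h2_0 x : 0 <= h2 x by rewrite h2E divr_ge0// addr_ge0.
have hg1 : forall x, h1 x < g1 x by apply: Xcase; rewrite h1E; lra.
have hg2 : forall x, h2 x < g2 x by apply: Xcase; rewrite h2E; lra.
split.
  (* Moving from [b] to [a] violates the condition for Player 1: it would force [2 * M <= M + 1]. *)
  case=> /(@discounted_supermartingale_one_step _ _ P delta1 g1 b a) + _.
  move=> /(_ P_markov delta1_discount g1_0); rewrite g1a g1b -/(q b a); nra.
case=> S [T [eqS eqT]].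
have ST x : S x -> ~ T x by exact: (equilibrium_disjoint P_markov _ _ _ _ _ eqS).
have TS x : T x -> ~ S x by move=> Tx /ST.
pose J1 x := expected_payoff P delta1 f1 g1 h1 x (rho_plus S) (rho T).
pose J2 x := expected_payoff P delta2 f2 g2 h2 x (rho_plus T) (rho S).
have J1_le x : S x -> (J1 x <= (f1 x)%:E)%E.
  by move=> Sx; apply: equilibrium_wait_le => //; exact: ST.
have J1_ge x : ~ S x -> ~ T x -> ((f1 x)%:E <= J1 x)%E.
  by move=> Sx Tx; apply: equilibrium_wait_ge.
have J2_le x : T x -> (J2 x <= (f2 x)%:E)%E.
  by move=> Tx; apply: equilibrium_wait_le => //; exact: TS.
have J2_ge x : ~ S x -> ~ T x -> ((f2 x)%:E <= J2 x)%E.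
  by move=> Sx Tx; apply: equilibrium_wait_ge.
have step1 x y v : 0 <= v -> S x -> (S y /\ v <= f1 y) \/ (T y /\ v <= g1 y) ->
    delta1 1%N * v * q x y <= f1 x.
  move=> v0 Sx yv; rewrite -lee_fin; apply: le_trans (J1_le _ Sx).
  by apply: wait_ge_one_step => //; exact: ST.
have step2 x y v : 0 <= v -> T x -> T y -> v <= f2 y -> delta2 1%N * v * q x y <= f2 x.
  move=> v0 Tx Ty vy; rewrite -lee_fin; apply: le_trans (J2_le _ Tx).
  by apply: wait_ge_one_step => //; [exact: TS|exact: TS|left].
(* If nobody stops at [b] and [a] is outside [T], waiting at [b] leads almost surely to a stop at
   [a] or [c]. There [f1] is 1, and only [g1 c = 2] can be collected from the opponent, so waiting
   is worth less than [f1 b = M]. *)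
have b_stop : ~ T a -> S c \/ T c -> S b \/ T b.
  move=> Ta c_stop; apply/not_notP => /not_orP[Sb Tb].
  have c_visited : {ae P b, forall w, exists n, w n = c}.
    by apply: (@ae_visits _ _ _ P_markov b a b c) => //;
      rewrite -transition_fineK lte_fin.
  have : (J1 b <= 2%:E)%E.
    apply: (@wait_le_visits _ _ _ P_markov _ _ _ _ _ _ _ b c) => //.
    - by apply: Xcase => //; lra.
    - by apply: Xcase => //; lra.
  by move=> /(le_trans (J1_ge b Sb Tb)); rewrite lee_fin; lra.
have c_stop : S c \/ T c.
  apply/not_notP => /not_orP[Sc Tc].
  (* [M ^+ 2 + 1] is the largest payoff of Player 2. Its excess of 1 is absorbed by [kdM], the loss
     from discounting. *)
  have : (J2 c <= (delta2 1%N * (M ^+ 2 + 1))%:E)%E.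
    apply: wait_le => //; first by nra.
    by apply: Xcase; split; rewrite ?h2E; nra.
  by move=> /(le_trans (J2_ge c Sc Tc)); rewrite lee_fin; nra.
have Tc : T c.
  case: c_stop => // Sc; have [Ta|Ta] := pselect (T a).
    have := step1 c a (M ^+ 2) (sqr_ge0 _) Sc (or_intror (conj Ta _)).
    by rewrite f1c g1a => /(_ (lexx _)); nra.
  (* Whichever player stops at [b], Player 1 receives at least [M] there, against 1 at [c]. *)
  have := step1 c b M _ Sc; rewrite f1b g1b f1c.
  case: (b_stop Ta (or_introl Sc)) => [Sb|Tb].
    by move=> /(_ _ (or_introl (conj Sb _))); nra.
  by move=> /(_ _ (or_intror (conj Tb _))); nra.
have Sc := TS _ Tc.
have Tb : ~ T b.
  move=> Tb; have := step2 b c (M ^+ 2) (sqr_ge0 _) Tb Tc.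
  by rewrite f2c f2b => /(_ (lexx _)); nra.
have [Ta|Ta] := pselect (T a).
  have [Sb|Sb] := pselect (S b).
    have := step1 b a (M ^+ 2) (sqr_ge0 _) Sb (or_intror (conj Ta _)).
    by rewrite f1b g1a => /(_ (lexx _)); nra.
  (* Now [b] lies in neither set, so Player 2 can pass from [a] through [b] to [c]; by [kabc] this
     is worth at least [2 * M], against [f2 a = M]. *)
  have : ((delta2 2%N * M ^+ 2 * (q a b * q b c))%:E <= J2 a)%E.
    by apply: wait_ge_two_steps => //; rewrite ?sqr_ge0 ?f2c//; exact: TS.
  by move/le_trans => /(_ _ (J2_le a Ta)); rewrite lee_fin f2a; nra.
have Sb : S b by case: (b_stop Ta (or_intror Tc)).
have [Sa|Sa] := pselect (S a).
  have := step1 a b M _ Sa (or_introl (conj Sb _)).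
  by rewrite f1a f1b; nra.
(* The roles of [S] and [T] are swapped here. The bound [M - 1] covers [g2 b = 2] because [M] is at
   least 3, and covers the discounted [h2 a = M + 1/2] by [kd]; it is still below [f2 a = M]. *)
have : (J2 a <= (M - 1)%:E)%E.
  apply: (@wait_le_barrier _ _ _ P_markov _ _ _ _ _ _ _ a b c) => //.
  - by lra.
  - by apply: Xcase => [/Sa|_|/Sc] //; rewrite g2b; lra.
  - by rewrite h2E f2a g2a; nra.
by move=> /(le_trans (J2_ge a Sa Ta)); rewrite lee_fin f2a; lra.
Qed.
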